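(* Let $g$ be a triangle, i.e. the complete network on $n=3$ individuals. Then there exists no direct mechanism satisfying both strategy-proofness and ex post efficiency.
   Context: Setting. There are three individuals, all pairwise linked. Each individual $i$ has a real characteristic $\theta_i$; a realization is a vector of pairwise distinct characteristics. Each individual observes the ordinal comparison of every pair of individuals (including pairs involving himself). Types. Individual $i$'s type is a matrix $T^i=[t^i_{jk}]$ with $t^i_{jk}\in\{-1,1\}$ for $j\ne k$, $t^i_{jk}=-t^i_{kj}$, $t^i_{jj}=0$; $t^i_{jk}=1$ means $\theta_j>\theta_k$ and $t^i_{jk}=-1$ means $\theta_j<\theta_k$. Any such matrix may be announced by $i$. A vector of (true) types is a profile ${\bf T}=(T^1,T^2,T^3)$ generated by some realization (so all three matrices coincide and encode a strict total order); for such ${\bf T}$ write $i\succ_{\bf T} j$ if $t^k_{ij}=1$. Mechanisms. A direct mechanism assigns to every vector of announced matrices a complete ranking $\rho$, i.e. a bijection $i\mapsto\rho_i\in\{1,2,3\}$; higher ranks are preferred. Strategy-proofness: for every individual $i$, every vector of announcements $\hat T^{-i}$ of the other individuals (not necessarily mutually consistent) and all types $T^i,T'^i$ of individual $i$, $\rho_i(T^i,\hat T^{-i})\ge\rho_i(T'^i,\hat T^{-i})$. Ex post efficiency: for every vector of types ${\bf T}$ and all $i,j$, $i\succ_{\bf T} j$ implies $\rho_i({\bf T})>\rho_j({\bf T})$. *)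

(* Defs.v *)
From HB Require Import structures.
From mathcomp Require Import all_boot all_order all_algebra all_fingroup.
From mathcomp Require Import reals.

Set Implicit Arguments.
Unset Strict Implicit.
Unset Printing Implicit Defensive.

Import Order.TTheory GRing.Theory Num.Theory.
Local Open Scope ring_scope.

(* Individuals are the elements of 'I_n; the network is complete, so that every
   individual observes every pair and the same matrices are available to all. *)

(* No transitivity is required: a type may encode a cyclic tournament. *)
Definition is_type (n : nat) (t : 'M[int]_n) : bool :=
  [forall j, t j j == 0] &&
  [forall j, forall k, (j != k) ==>
     ((t j k == 1) || (t j k == -1)) && (t j k == - t k j)].

Definition itype (n : nat) := {t : 'M[int]_n | is_type t}.

Definition profile (n : nat) := {ffun 'I_n -> itype n}.

(* t^i_{jk} *)
Definition report (n : nat) (T : profile n) (i j k : 'I_n) : int :=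
  val (T i) j k.

Definition generated_by (R : realType) (n : nat)
    (theta : 'I_n -> R) (T : profile n) : Prop :=
  forall i j k : 'I_n,
    (report T i j k = 1 <-> theta k < theta j) /\
    (report T i j k = -1 <-> theta j < theta k).

Definition true_types (R : realType) (n : nat) (T : profile n) : Prop :=
  exists theta : 'I_n -> R, injective theta /\ generated_by theta T.

(* On true types all matrices coincide, so the choice of k is immaterial. *)
Definition above (n : nat) (T : profile n) (i j : 'I_n) : Prop :=
  exists k : 'I_n, report T k i j = 1.

(* A complete ranking is a bijection of 'I_n; the rank in {1, ..., n} is the
   value of the permutation plus one. *)
Definition mechanism (n : nat) := profile n -> 'S_n.

Definition rank (n : nat) (rho : mechanism n) (T : profile n) (i : 'I_n) : nat :=
  (rho T i).+1.

(* (t, That^{-i}): the i-th component of That is discarded. *)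
Definition with_type (n : nat) (That : profile n) (i : 'I_n) (t : itype n) :
    profile n :=
  [ffun j => if j == i then t else That j].

Definition strategy_proof (n : nat) (rho : mechanism n) : Prop :=
  forall (i : 'I_n) (That : profile n) (t t' : itype n),
    (rank rho (with_type That i t') i <= rank rho (with_type That i t) i)%N.

Definition ex_post_efficient (R : realType) (n : nat) (rho : mechanism n) : Prop :=
  forall T : profile n, true_types R T ->
  forall i j : 'I_n, above T i j -> (rank rho T j < rank rho T i)%N.

(* Main.v *)
(* Strategy-proofness makes the rank of an individual independent of his own
   announcement.  Let S_i be a type of a strict order in which i is in the
   middle; by efficiency i gets the middle rank when everybody announces S_i,
   hence whenever the two others announce S_i.  Let now every individual i
   announce S_(i-1), indices being taken modulo 3.  If i deviates to S_(i+1),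
   then both i and i-1 announce S_(i+1), so that i+1 gets the middle rank and i
   does not.  The rank of i is the same without the deviation, so nobody gets
   the middle rank. *)
Require Import Defs.
From mathcomp Require Import all_boot all_order all_algebra all_fingroup.
From mathcomp Require Import reals.

Set Implicit Arguments.
Unset Strict Implicit.
Unset Printing Implicit Defensive.

Import Order.TTheory GRing.Theory Num.Theory.
Local Open Scope ring_scope.

Definition order_matrix (n : nat) (f : 'I_n -> int) : 'M[int]_n :=
  \matrix_(j, k) sgz (f j - f k).

Lemma order_matrix_is_type (n : nat) (f : 'I_n -> int) :
  injective f -> is_type (order_matrix f).
Proof.
move=> f_inj; apply/andP; split.
  by apply/forallP => j; rewrite mxE subrr sgz0.
apply/forallP => j; apply/forallP => k; apply/implyP => j_neq_k.
rewrite !mxE -(opprB (f j)) sgzN opprK eqxx andbT.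
by have := j_neq_k; rewrite -(inj_eq f_inj) -subr_eq0; case: sgzP.
Qed.

Definition order_type (n : nat) (f : 'I_n -> int) (f_inj : injective f) :
  itype n := exist _ (order_matrix f) (order_matrix_is_type f_inj).

Lemma report_order_type (n : nat) (f : 'I_n -> int) (f_inj : injective f)
    (i j k : 'I_n) :
  report [ffun=> order_type f_inj] i j k = sgz (f j - f k).
Proof. by rewrite /report ffunE mxE. Qed.

(** The integers [f j], embedded in [R], serve as characteristics. *)
Lemma true_types_order_type (R : realType) (n : nat) (f : 'I_n -> int)
    (f_inj : injective f) :
  true_types R [ffun=> order_type f_inj].
Proof.
exists (fun j => (f j)%:~R); split=> [j k /intr_inj/f_inj //|i j k].
rewrite report_order_type !ltr_int -(subr_gt0 (f k)) -(subr_lt0 (f k)).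
by case: sgzP.
Qed.

Lemma efficient_order_type (R : realType) (n : nat) (rho : mechanism n)
    (f : 'I_n -> int) (f_inj : injective f) (j k : 'I_n) :
  ex_post_efficient R rho -> f j < f k ->
  (rho [ffun=> order_type f_inj] j < rho [ffun=> order_type f_inj] k)%N.
Proof.
move=> rho_eff f_jk; apply: (rho_eff _ (true_types_order_type R f_inj)).
by exists j; rewrite report_order_type gtr0_sgz // subr_gt0.
Qed.

(** Each of the two profiles arises from the other by a deviation of [i], so strategy-proofness
    bounds the rank both ways. *)
Lemma strategy_proof_rank (n : nat) (rho : mechanism n) (i : 'I_n)
    (T T' : profile n) :
  strategy_proof rho -> (forall j, j != i -> T j = T' j) -> rho T i = rho T' i.
Proof.
move=> rho_sp eq_T.
have with_T : with_type T i (T i) = T.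
  by apply/ffunP => j; rewrite ffunE; case: eqP => [->|].
have with_T' : with_type T i (T' i) = T'.
  by apply/ffunP => j; rewrite ffunE; case: eqVneq => [->|/eq_T].
apply/val_inj/eqP; rewrite eqn_leq.
have := rho_sp i T (T i) (T' i); have := rho_sp i T (T' i) (T i).
by rewrite /rank with_T with_T' !ltnS => -> ->.
Qed.

(* [i - 1], [i] and [i + 1] (modulo 3) have positions 0, 1 and 2. *)
Definition middle_order (i j : 'I_3) : int := (val (j - i + 1) : nat).

Lemma middle_order_inj (i : 'I_3) : injective (middle_order i).
Proof. by move=> j k /eqP; rewrite eqz_nat => /eqP/val_inj/addIr/addIr. Qed.

Definition middle_type (i : 'I_3) : itype 3 := order_type (@middle_order_inj i).

(** Values of [rho T] count from 0, so [1] in ['I_3] is the middle rank. Efficiency applies once [i]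
    also announces [middle_type i]. *)
Lemma middle_rank (R : realType) (rho : mechanism 3) (i : 'I_3)
    (T : profile 3) :
  strategy_proof rho -> ex_post_efficient R rho ->
  (forall j, j != i -> T j = middle_type i) -> rho T i = 1.
Proof.
move=> rho_sp rho_eff T_i.
have -> : rho T i = rho [ffun=> middle_type i] i.
  by apply: strategy_proof_rank => // j /T_i ->; rewrite ffunE.
have lt_below : middle_order i (i - 1) < middle_order i i.
  by rewrite /middle_order addrAC subrK subrr add0r.
have lt_above : middle_order i i < middle_order i (i + 1).
  by rewrite /middle_order subrr add0r (addrC i) addrK.
have := efficient_order_type (@middle_order_inj i) rho_eff lt_below.
have := efficient_order_type (@middle_order_inj i) rho_eff lt_above.
rewrite -/(middle_type i).
case: (rho _ i) => [[|[|[|m]]] lt_m3] // lt_i _; first exact/val_inj.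
by have := leq_trans lt_i (leq_ord _).
Qed.

Theorem proposition3 (R : realType) :
  ~ exists rho : mechanism 3, strategy_proof rho /\ ex_post_efficient R rho.
Proof.
case=> rho [rho_sp rho_eff].
pose T : profile 3 := [ffun i => middle_type (i - 1)].
have not_middle i : rho T i != 1.
  pose T' := with_type T i (middle_type (i + 1)).
  have -> : rho T i = rho T' i.
    apply: strategy_proof_rank => // j /negPf j_i.
    by rewrite [RHS]ffunE j_i.
  have <- : rho T' (i + 1) = 1.
    apply: middle_rank rho_sp rho_eff _ => j j_neq.
    (* The remaining [j] is [i - 1], and [j - 1 = i - 2 = i + 1] modulo 3. *)
    rewrite ffunE; case: eqVneq => // j_i; rewrite ffunE; congr middle_type.
    apply/eqP; move: i j j_neq j_i {T'}.
    by do 2![case=> [[|[|[|?]]] ?] //].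
  by rewrite (inj_eq perm_inj) -subr_eq0 opprD addNKr.
(* A permutation attains every value, so some individual does get the middle rank. *)
by have := not_middle ((rho T)^-1%g 1); rewrite permKV eqxx.
Qed.
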